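(* Let $k \ge 4$ be a fixed integer. Assume that $n, m_1, m_2, \ldots, m_{k-1}$ are positive integers with \[ n = (k-1) + \sum_{i=1}^{k-1} m_i . \] Then \[ f_k(n) \le 4 \sum_{i=1}^{k-2} 2^{m_i} + 2^{k-2}\, 2^{m_{k-1}} - 7(k-2). \]
   Context: Let $[n] = \{1,2,\ldots,n\}$. For integers $n,k \ge 2$, a family $\mathcal{F}$ of subsets of $[n]$ is called $k$-wise intersecting if every (non-empty) collection of at most $k$ members of $\mathcal{F}$ has a non-empty intersection. A family $\mathcal{F}$ of subsets of $[n]$ is called maximal $k$-wise intersecting if it is $k$-wise intersecting and adding to $\mathcal{F}$ any subset of $[n]$ not already in $\mathcal{F}$ yields a family that is not $k$-wise intersecting. Let $f_k(n)$ denote the minimum possible size (number of members) of a maximal $k$-wise intersecting family of subsets of $[n]$. *)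

(* Defs.v *)
From mathcomp Require Import all_boot.

Set Implicit Arguments.
Unset Strict Implicit.
Unset Printing Implicit Defensive.

(* The ground set [n] is 'I_n. *)

Definition kwise_intersecting (k n : nat) (F : {set {set 'I_n}}) : bool :=
  [forall G : {set {set 'I_n}},
     [&& G \subset F, G != set0 & #|G| <= k] ==> (\bigcap_(A in G) A != set0)].

Definition maximal_kwise_intersecting (k n : nat) (F : {set {set 'I_n}}) : bool :=
  kwise_intersecting k F &&
  [forall A : {set 'I_n}, (A \notin F) ==> ~~ kwise_intersecting k (A |: F)].

Lemma maximal_kwise_intersecting_size_ex (k n : nat) :
  exists s : nat,
    [exists F : {set {set 'I_n}}, maximal_kwise_intersecting k F && (#|F| == s)].
Proof.
have P0 : kwise_intersecting k (set0 : {set {set 'I_n}}).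
  apply/forallP => G; apply/implyP => /and3P[].
  by rewrite subset0 => ->.
have [F /maxsetP[PF maxF] _] := maxset_exists P0.
exists #|F|; apply/existsP; exists F; rewrite eqxx andbT /maximal_kwise_intersecting.
rewrite PF; apply/forallP => A; apply/implyP => AF; apply/negP => PA.
by move: AF; rewrite -(maxF _ PA (subsetU1 A F)) setU11.
Qed.

(* f_k(n) *)
Definition f (k n : nat) : nat :=
  ex_minn (maximal_kwise_intersecting_size_ex k n).

(* Main.v *)
Require Import Defs.
From mathcomp Require Import all_boot zify.

Set Implicit Arguments.
Unset Strict Implicit.
Unset Printing Implicit Defensive.

(** Pass to complements: one needs a down-closed family in which no [k] members
    cover the ground set, while every non-member together with some [k - 1]
    members does.  Let [q = k - 2], and split the ground set into blocks
    [V_1, ..., V_q] with [#|V_i| = m_i] and a core [W] of size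
    [k - 1 + m_(k-1)] containing a hub [c], points [x_1, ..., x_q] and a further
    point [v]; the spokes are [P_i = {c, x_i}].  Call [h], a subset of [W],
    light if [c] lies in [h] and [h] is inside a spoke, or [c] does not lie in
    [h] and [W \ h] is inside no spoke.  Lightness is down-closed, exactly one
    of [h] and [W \ h] is light, and every [P_i] is a maximal light set.  The
    family consists of the light sets ([2^(q + m_(k-1))] of them), the blocks
    [V_i], and the sets [A :|: S] with [A] a proper nonempty part of [V_i] and
    [S] inside [P_i] ([4 * (2^m_i - 2)] for each [i]).  Covering the blocks uses
    up [q] members, and the two left cannot cover [W]. *)

(** * Blocks, core, spokes and the family of complements *)

Section Construction.

Variables (T : finType) (q : nat) (lab : T -> option 'I_q).
Variables (c v : T) (x : 'I_q -> T).

Definition block (i : 'I_q) : {set T} := [set t | lab t == Some i].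
Definition core : {set T} := [set t | lab t == None].
Definition spoke (i : 'I_q) : {set T} := [set c; x i].

Implicit Types (A B h : {set T}) (i j : 'I_q) (t : T).

Definition in_spoke (h : {set T}) : bool := [exists i, h \subset spoke i].
Definition light (h : {set T}) : bool :=
  if c \in h then in_spoke h else ~~ in_spoke (core :\: h).

(** When [B] misses the block, the last clause only yields subsets of a spoke, which are light
    already; its new members are the mixed sets. *)
Definition cofamily : {set {set T}} :=
  [set B : {set T} | (B \subset core) && light B
        || [exists i, (B == block i)
                   || (B \subset block i :|: spoke i) && ~~ (block i \subset B)]].

Hypothesis q_gt1 : 1 < q.
Hypothesis lab_surj : forall i, exists t, lab t = Some i.
Hypotheses (c_core : c \in core) (v_core : v \in core).
Hypothesis x_core : forall i, x i \in core.
Hypothesis x_inj : injective x.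
Hypothesis x_neq_c : forall i, x i != c.
Hypothesis v_neq_c : v != c.
Hypothesis v_neq_x : forall i, v != x i.

(** * Light sets *)

Lemma v_notin_spoke i : v \notin spoke i.
Proof. by rewrite !inE negb_or v_neq_c v_neq_x. Qed.

Lemma spoke_core i : spoke i \subset core.
Proof. by apply/subsetP => t /set2P[] ->. Qed.

Lemma block_core_disjoint i t : t \in block i -> t \notin core.
Proof. by rewrite !inE => /eqP ->. Qed.

Lemma in_block_inj i j t : t \in block i -> t \in block j -> i = j.
Proof. by rewrite !inE => /eqP -> /eqP[]. Qed.

Lemma block_or_core t : (exists i, t \in block i) \/ t \in core.
Proof.
by case E: (lab t) => [i|]; [left; exists i | right]; rewrite inE E.
Qed.

Lemma light_setC h : h \subset core -> light (core :\: h) = ~~ light h.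
Proof.
move=> hW; rewrite /light inE c_core andbT.
case: ifP => [/negPf-> | /negbFE ->]; rewrite ?negbK //.
by rewrite setDDr setDv set0U (setIidPr hW).
Qed.

(** The delicate case is a hub in [h] but not in [h']: if [core :\: h'] lay in a spoke, then [v],
    which is in no spoke, would belong to [h'], hence to the spoke around [h]. *)
Lemma light_sub h h' : h' \subset h -> light h -> light h'.
Proof.
move=> sub; rewrite /light; case: ifP => [ch /existsP[i hi] | /negbT ch].
  case: ifP => [ch' | /negbT ch'].
    by apply/existsP; exists i; apply: subset_trans sub hi.
  apply/negP => /existsP[j /subsetP hj].
  have vh' : v \in h'.
    by apply: contraT => vh'; rewrite -(negPf (v_notin_spoke j)) hj // inE vh'.
  by move: (v_notin_spoke i); rewrite (subsetP (subset_trans sub hi)).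
move=> H; rewrite (contraNF (subsetP sub c)) //.
apply: contra H => /existsP[i hi]; apply/existsP; exists i.
exact: subset_trans (setDS _ sub) hi.
Qed.

(** If they covered, [h2] would contain the part of the core outside [h1], which is not light, being
    the relative complement of a light set; this contradicts down-closure. *)
Lemma light_not_cover h1 h2 :
  light h1 -> light h2 -> ~~ (core \subset h1 :|: h2).
Proof.
move=> H1 H2; apply/negP => cov.
have /light_sub/(_ H2): core :\: (h1 :&: core) \subset h2.
  apply/subsetP => t; rewrite !inE => /andP[t1 tW].
  by move: (subsetP cov t); rewrite !inE tW => /(_ isT) /orP[] // th; rewrite th tW in t1.
rewrite light_setC ?subsetIr // => /negP; apply.
exact: light_sub (subsetIl _ _) H1.
Qed.

Lemma light_spoke i : light (spoke i).
Proof. by rewrite /light !inE eqxx; apply/existsP; exists i. Qed.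

(** Serves saturation: [h] and [core :\: (w |: h)] are then both light and miss only [w] in the
    core. For the hub take [[set v]], light because every spoke misses some [x j]; otherwise take a
    spoke not ending at [w]. *)
Lemma light_pivot w :
  w \in core -> exists2 h : {set T}, (h \subset core) && light h & ~~ light (w |: h).
Proof.
move=> wW; have [->|wc] := eqVneq w c.
  exists [set v]; last first.
    rewrite /light !inE eqxx /=; apply/existsPn => i; apply/negP => /subsetP s.
    by move: (s v); rewrite (negPf (v_notin_spoke i)) !inE eqxx orbT => /(_ isT).
  rewrite sub1set v_core /light inE eq_sym (negPf v_neq_c).
  apply/existsPn => i; apply/negP => /subsetP s.
  have [j ji] : exists j : 'I_q, j != i.
    case: (eqVneq (Ordinal q_gt1) i) => [<-|]; last by exists (Ordinal q_gt1).
    by exists (Ordinal (ltnW q_gt1)).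
  move: (s (x j)); rewrite !inE eq_sym v_neq_x (negPf (x_neq_c j)) /=.
  have := x_core j; rewrite inE => -> /(_ isT) /eqP /x_inj E.
  by rewrite E eqxx in ji.
have [j xjw] : exists j, x j != w.
  have [E|] := eqVneq (x (Ordinal (ltnW q_gt1))) w; last by exists (Ordinal (ltnW q_gt1)).
  by exists (Ordinal q_gt1); rewrite -E; apply/eqP => /x_inj.
exists (spoke j); first by rewrite spoke_core light_spoke.
rewrite /light !inE eqxx orbT; apply/existsPn => i; apply/negP => /subsetP s.
move: (s w); rewrite !inE eqxx (negPf wc) => /(_ isT) /eqP E1.
move: (s (x j)); rewrite !inE eqxx !orbT (negPf (x_neq_c _)) => /(_ isT) /eqP E2.
by rewrite E2 -E1 eqxx in xjw.
Qed.

(** * Membership in the cofamily *)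

Lemma cofamilyP B :
  reflect ([/\ B \subset core & light B] \/
           exists i, B = block i \/ B \subset block i :|: spoke i /\ ~~ (block i \subset B))
          (B \in cofamily).
Proof.
rewrite inE; apply: (iffP orP) => -[H|H].
- by left; case/andP: H.
- right; case/existsP: H => i /orP[/eqP|/andP] H; exists i; first by left.
  by right.
- by left; apply/andP.
- right; case: H => i H; apply/existsP; exists i; apply/orP.
  by case: H => [->|/andP H]; [left | right].
Qed.

Lemma cofamily_core h : h \subset core -> light h -> h \in cofamily.
Proof. by move=> hW lh; apply/cofamilyP; left. Qed.

Lemma cofamily_block i : block i \in cofamily.
Proof. by apply/cofamilyP; right; exists i; left. Qed.

(** Blocks are disjoint from each other and from the core, so a member meets at most one block and
    must be of that block's kind. *)
Lemma cofamily_meet B i t :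
  B \in cofamily -> t \in block i -> t \in B ->
  B = block i \/ B \subset block i :|: spoke i /\ ~~ (block i \subset B).
Proof.
move=> /cofamilyP[[BW _]|[j Bj]] ti tB.
  by move: (block_core_disjoint ti); rewrite (subsetP BW).
suff -> : i = j by [].
case: Bj => [E|[/subsetP/(_ t tB)]]; first by apply: in_block_inj ti _; rewrite -E.
rewrite inE => /orP[tj|ts] _; first exact: in_block_inj ti tj.
by move: (block_core_disjoint ti); rewrite (subsetP (spoke_core j)).
Qed.

Lemma cofamily_light B : B \in cofamily -> B \subset core -> light B.
Proof.
move=> /cofamilyP[[_ ->] //|[i [->|[/subsetP sub _]]]] /subsetP BW.
  have [t ti] := lab_surj i; have tB : t \in block i by rewrite inE ti.
  by move: (block_core_disjoint tB); rewrite BW.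
apply: light_sub (light_spoke i); apply/subsetP => t tB.
move: (sub t tB); rewrite inE => /orP[ti|//].
by move: (block_core_disjoint ti); rewrite BW.
Qed.

(** * No [q.+2] members cover the ground set *)

Lemma set0_cofamily : set0 \in cofamily.
Proof.
apply: cofamily_core; rewrite ?sub0set //.
exact: light_sub (sub0set _) (light_spoke (Ordinal (ltnW q_gt1))).
Qed.

(* A subfamily covering the ground set has, for each block, a member
   meeting that block.  After discarding these [q] members, each of the at
   most two others can be replaced by a light set (itself, or the spoke of the
   block it meets) so that the core is still covered. *)
Lemma cofamily_not_cover (G : {set {set T}}) :
  G \subset cofamily -> #|G| <= q.+2 -> \bigcup_(B in G) B != setT.
Proof.
move=> /subsetP GF cardG; apply/eqP => cov.
have covE t : exists2 B : {set T}, B \in G & t \in B by apply/bigcupP; rewrite cov inE.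
have meet_inj B i j t u : B \in G -> t \in block i -> t \in B ->
    u \in block j -> u \in B -> i = j.
  move=> /GF BF ti tB uj uB; case: (cofamily_meet BF ti tB) => [E|[/subsetP/(_ u uB)]].
    by apply: in_block_inj uj; rewrite -E.
  rewrite inE => /orP[ui _|us]; first exact: in_block_inj uj.
  by move: (block_core_disjoint uj); rewrite (subsetP (spoke_core i)).
have repE i : exists B : {set T}, B \in G /\ exists2 t, t \in block i & t \in B.
  have [t ti] := lab_surj i; have [B BG tB] := covE t.
  by exists B; split=> //; exists t; rewrite // inE ti.
have [r rP] := fin_all_exists repE.
have r_inj : injective r.
  move=> i j E; have [rG [t ti tr]] := rP i; have [_ [u uj ur]] := rP j.
  by apply: (meet_inj (r i) _ _ t u) => //; rewrite E.
pose N := G :\: r @: setT.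
have cardN : #|N| <= 2.
  rewrite cardsD (setIidPr _).
    by rewrite card_imset // cardsT card_ord leq_subLR addn2.
  by apply/subsetP => _ /imsetP[i _ ->]; case: (rP i).
pose repl B := if [pick i | [exists t in block i, t \in B]] is Some i then spoke i else B.
have repl_light B : B \in cofamily -> light (repl B).
  rewrite /repl; case: pickP => [i _ _|noB BF]; first exact: light_spoke.
  apply: cofamily_light => //; apply/subsetP => t tB.
  have [[i ti]|//] := block_or_core t.
  by move: (noB i) => /existsP[]; exists t; rewrite ti.
have repl_spoke B i t : B \in G -> t \in block i -> t \in B -> repl B = spoke i.
  move=> BG ti tB; rewrite /repl; case: pickP => [j /existsP[u /andP[uj uB]]|noB].
    by rewrite (meet_inj B i j t u).
  by move: (noB i) => /existsP[]; exists t; rewrite ti.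
(* Padding with [set0] or repeating a member fits the leftovers into a pair. *)
have [a [b [aF bF sub]]] :
    exists a b, [/\ a \in cofamily, b \in cofamily & N \subset [set a; b]].
  have NF B : B \in enum N -> B \in cofamily by rewrite mem_enum inE => /andP[_ /GF].
  move: cardN; rewrite cardE.
  case E: (enum N) NF => [|a [|b [|? ?]]] NF // _.
  - exists set0, set0; rewrite set0_cofamily; split=> //.
    by apply/subsetP => B; rewrite -mem_enum E.
  - exists a, a; rewrite NF ?mem_head; split=> //.
    by apply/subsetP => B; rewrite -mem_enum E !inE orbb.
  - exists a, b; rewrite !NF ?inE ?eqxx ?orbT; split=> //.
    by apply/subsetP => B; rewrite -mem_enum E !inE.
have /subsetPn[w wW] := light_not_cover (repl_light a aF) (repl_light b bF).
apply/negP; rewrite negbK.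
suff [B BN wB] : exists2 B : {set T}, B \in N & w \in repl B.
  by case/set2P: (subsetP sub _ BN) wB => ->; rewrite inE => ->; rewrite ?orbT.
have [B BG wB] := covE w.
have [BN|] := boolP (B \in N).
  exists B => //; rewrite /repl; case: pickP => // i /existsP[t /andP[ti tB]].
  have [E|[/subsetP/(_ w wB)]] := cofamily_meet (GF _ BG) ti tB.
    by rewrite E in wB; rewrite (negPf (block_core_disjoint wB)) in wW.
  by rewrite inE => /orP[/block_core_disjoint/negP[]|].
(* Here [w] is covered by a discarded [B], a mixed set missing some [u] in [block i]. A member
   covering [u] could only represent block [i], which [B] does already; so it lies in [N], and its
   replacement [spoke i] contains [w]. *)
rewrite inE BG andbT negbK => /imsetP[i _ Bri].
have [_ [t ti]] := rP i; rewrite -Bri => tB.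
have [E|[/subsetP/(_ w wB) wi /subsetPn[u ui uB]]] := cofamily_meet (GF _ BG) ti tB.
  by rewrite E in wB; rewrite (negPf (block_core_disjoint wB)) in wW.
have [B' B'G uB'] := covE u.
exists B'.
  rewrite inE B'G andbT; apply/negP => /imsetP[j _ B'rj].
  have [_ [s sj]] := rP j; rewrite -B'rj => sB'.
  have ij := meet_inj B' i j u s B'G ui uB' sj sB'.
  by move: uB; rewrite Bri ij -B'rj uB'.
rewrite (repl_spoke B' i u) //; move: wi; rewrite inE => /orP[/block_core_disjoint/negP[]|] //.
Qed.

(** * Saturation *)

(** The bound [q.+1] is [k - 1]: one member for each block and one spare; coincidences only lower
    the count. *)
Lemma cover_of_members (g : 'I_q -> {set T}) h B :
  (forall i, g i \in cofamily) -> h \in cofamily ->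
  (forall t, [|| t \in B, t \in h | [exists i, t \in g i]]) ->
  exists G : {set {set T}},
    [/\ G \subset cofamily, #|G| <= q.+1 & B :|: \bigcup_(A in G) A = setT].
Proof.
move=> gF hF cov; exists (h |: g @: setT); split.
- by apply/subsetP => A /setU1P[-> //|/imsetP[i _ ->]].
- rewrite cardsU1; have := leq_imset_card g setT; rewrite cardsT card_ord.
  by case: (_ \notin _) => le; [rewrite add1n ltnS | exact: leqW].
apply/setP => t; rewrite !inE; case/or3P: (cov t) => [->//|th|/existsP[i ti]].
  by apply/orP; right; apply/bigcupP; exists h; rewrite ?setU11.
apply/orP; right; apply/bigcupP; exists (g i) => //.
by apply/setU1P; right; apply: imset_f.
Qed.

(** Finishing a block that [B] meets brings its spoke for free, so only [core :\: Q] remains for the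
    spare member. If [Q] is not light, this complement is light and serves; if [Q] is light, [B] has
    a very restricted form. *)
Lemma cofamily_saturated B :
  B \notin cofamily ->
  exists G : {set {set T}},
    [/\ G \subset cofamily, #|G| <= q.+1 & B :|: \bigcup_(A in G) A = setT].
Proof.
move=> BF.
pose meets i := [exists t in block i, t \in B].
pose g i := if meets i then (block i :\: B) :|: spoke i else block i.
pose Q := (B :&: core) :|: \bigcup_(i | meets i) spoke i.
have QW : Q \subset core.
  rewrite subUset subsetIr; apply/bigcupsP => i _; exact: spoke_core.
have [lQ|lQ] := boolP (light Q); last first.
  apply: (@cover_of_members g (core :\: Q) B) => [i||t].
  - rewrite /g; case: ifP => [/existsP[t /andP[ti tB]]|_]; last exact: cofamily_block.
    apply/cofamilyP; right; exists i; right; split; first exact: setSU (subsetDl _ _).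
    apply/subsetPn; exists t; rewrite // !inE tB /=; apply/negP => ts.
    by move: (block_core_disjoint ti); rewrite (subsetP (spoke_core i)) // !inE.
  - by apply: cofamily_core; rewrite ?subsetDl ?light_setC.
  have [//|tB /=] := boolP (t \in B).
  have [[i ti]|tW] := block_or_core t.
    apply/orP; right; apply/existsP; exists i; rewrite /g.
    by case: ifP => // _; rewrite in_setU in_setD tB ti.
  rewrite in_setD tW andbT in_setU in_setI (negPf tB) /=.
  case: (boolP (t \in \bigcup_(i | meets i) spoke i)) => [/bigcupP[i mi ti]|//] /=.
  by apply/existsP; exists i; rewrite /g mi in_setU ti orbT.
have [BW|/subsetPn[t tB tW]] := boolP (B \subset core).
  case/negP: BF; apply: cofamily_core => //; apply: light_sub lQ.
  by rewrite /Q (setIidPl BW) subsetUl.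
have [[i ti]|] := block_or_core t; last by rewrite (negPf tW).
have mi : meets i by apply/existsP; exists t; rewrite ti.
have sQ j : meets j -> spoke j \subset Q.
  by move=> mj; apply: subset_trans (subsetUr _ _); apply: bigcup_sup.
have cQ : c \in Q by apply: (subsetP (sQ i mi)); rewrite !inE eqxx.
(* A light [Q] containing the hub lies in one spoke, so by injectivity of [x] only block [i] is
   met. *)
move: lQ; rewrite /light cQ => /existsP[l Ql].
have lE j : meets j -> j = l.
  move=> mj; have := subsetP (subset_trans (sQ j mj) Ql) (x j).
  rewrite !inE eqxx orbT (negPf (x_neq_c _)) => /(_ isT) /eqP; exact: x_inj.
have iE := lE i mi.
have {lE} mE j : meets j -> j = i by rewrite iE; apply: lE.
have Bsub : B \subset block i :|: spoke i.
  apply/subsetP => u uB; rewrite in_setU.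
  have [[j uj]|uW] := block_or_core u.
    by rewrite -(mE j) ?uj //; apply/existsP; exists u; rewrite uj.
  by rewrite iE (subsetP Ql) ?orbT // in_setU in_setI uB uW.
have blockB : block i \subset B.
  apply: contraT => nB; case/negP: BF; apply/cofamilyP; right.
  by exists i; right.
have [w wB wW] : exists2 w, w \in B & w \in core.
  have /subsetPn[w wB wi] : ~~ (B \subset block i).
    apply/negP => Bi; case/negP: BF.
    have -> : B = block i by apply/eqP; rewrite eqEsubset Bi.
    exact: cofamily_block.
  exists w => //; move: (subsetP Bsub w wB); rewrite in_setU (negPf wi) /=.
  exact: subsetP (spoke_core i) w.
(* [B] already contains [block i] and [w], so the slot of block [i] is free for [h], and the spare
   one goes to [core :\: (w |: h)]. *)
have [h /andP[hW lh] lwh] := light_pivot wW.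
apply: (@cover_of_members (fun j => if j == i then h else block j) (core :\: (w |: h)) B).
- by move=> j; case: ifP => _; [exact: cofamily_core | exact: cofamily_block].
- by apply: cofamily_core; rewrite ?subsetDl ?light_setC // subUset sub1set wW.
move=> u; have [//|uB /=] := boolP (u \in B).
have [[j uj]|uW] := block_or_core u.
  apply/orP; right; apply/existsP; exists j; case: eqP => [ji|//].
  by rewrite ji in uj; rewrite (subsetP blockB) in uB.
rewrite in_setD uW andbT in_setU1 negb_or; have [uh|uh] := boolP (u \in h).
  by apply/orP; right; apply/existsP; exists i; rewrite eqxx.
by rewrite andbT (contraNneq _ uB) // => ->.
Qed.

(** * Counting *)

(** Relative complement in the core exchanges light and non-light subsets, so each kind makes up
    half. *)
Lemma card_light : #|[set B : {set T} | (B \subset core) && light B]| = 2 ^ #|core|.-1.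
Proof.
set L := [set _ | _].
have DK B : B \subset core -> core :\: (core :\: B) = B.
  by move=> BW; rewrite setDDr setDv set0U (setIidPr BW).
have LC : powerset core :\: L = [set core :\: B | B in L].
  apply/setP => B; apply/idP/imsetP => [|[A]].
    rewrite !inE => /andP[+ BW]; rewrite BW /= => lB.
    by exists (core :\: B); rewrite ?DK // inE subsetDl light_setC.
  by rewrite inE => /andP[AW lA] ->; rewrite !inE subsetDl light_setC ?lA.
have cardLC : #|powerset core :\: L| = #|L|.
  rewrite LC card_in_imset // => A B; rewrite !inE => /andP[AW _] /andP[BW _] E.
  by rewrite -(DK A) // E DK.
have := cardsID L (powerset core).
rewrite cardLC card_powerset (setIidPr _); last first.
  by apply/subsetP => B; rewrite !inE => /andP[].
have : 0 < #|core| by apply/card_gt0P; exists c.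
case: #|core| => // n _; rewrite expnS addnn -mul2n => /eqP.
by rewrite eqn_pmul2l // => /eqP.
Qed.

(** A block of size [m] contributes itself and at most [4 * (2 ^ m - 2)] mixed sets, [4 * 2 ^ m - 7]
    in all. The term [7 * q] stands on the left to avoid truncated subtraction. *)
Lemma card_cofamily :
  #|cofamily| + 7 * q <= 2 ^ #|core|.-1 + 4 * \sum_(i < q) 2 ^ #|block i|.
Proof.
pose L := [set B : {set T} | (B \subset core) && light B].
pose M i := [set B.1 :|: B.2 | B in setX (powerset (block i) :\: [set set0; block i])
                                        (powerset (spoke i))].
have sub : cofamily \subset L :|: \bigcup_(i < q) (block i |: M i).
  apply/subsetP => B BF; rewrite in_setU.
  have [BW|/subsetPn[t tB tW]] := boolP (B \subset core).
    by rewrite inE BW cofamily_light.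
  have [[i ti]|] := block_or_core t; last by rewrite (negPf tW).
  apply/orP; right; apply/bigcupP; exists i => //; apply/setU1P.
  have [->|[Bsub nB]] := cofamily_meet BF ti tB; [by left | right].
  apply/imsetP; exists (B :&: block i, B :&: spoke i); last by rewrite -setIUr (setIidPl Bsub).
  rewrite !inE !subsetIr !andbT negb_or; apply/andP; split.
    by apply/set0Pn; exists t; rewrite inE tB.
  by apply: contra nB => /eqP/setIidPr.
have cardM i : #|block i |: M i| + 7 <= 4 * 2 ^ #|block i|.
  have b0 : set0 != block i.
    by have [t ti] := lab_surj i; rewrite eq_sym; apply/set0Pn; exists t; rewrite inE ti.
  have cM : #|M i| <= (2 ^ #|block i| - 2) * 4.
    apply: leq_trans (leq_imset_card _ _) _.
    rewrite cardsX cardsD card_powerset (setIidPr _) ?cards2 ?b0.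
      by rewrite card_powerset cards2 eq_sym x_neq_c.
    by apply/subsetP => A /set2P[] ->; rewrite inE ?sub0set.
  (* A nonempty block makes the subtraction of 2 in [cM] exact. *)
  have : 2 <= 2 ^ #|block i|.
    rewrite -{1}(expn1 2) leq_exp2l // card_gt0 eq_sym //.
  rewrite cardsU1; move: cM; case: (_ \notin _); move: (2 ^ _) #|M i| => ? ? ? ?; lia.
have cU : #|\bigcup_(i < q) (block i |: M i)| + 7 * q <= 4 * \sum_(i < q) 2 ^ #|block i|.
  have -> : 7 * q = \sum_(i < q) 7 by rewrite sum_nat_const card_ord mulnC.
  rewrite big_distrr /=; apply: (@leq_trans (\sum_(i < q) (#|block i |: M i| + 7))); last first.
    by apply: leq_sum => i _; exact: cardM.
  rewrite [leqRHS]big_split /= leq_add2r.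
  elim/big_ind2: _ => [|A a A' a' Aa Aa'|//]; first by rewrite cards0.
  exact: leq_trans (leq_card_setU _ _) (leq_add Aa Aa').
have le := leq_trans (subset_leq_card sub) (leq_card_setU _ _).
apply: leq_trans (leq_add le (leqnn _)) _.
by rewrite -addnA; apply: leq_add cU; rewrite card_light.
Qed.

End Construction.

(** * Back to intersecting families *)

(** De Morgan turns empty intersections into covers; the strict bound [#|G| < k] leaves room for the
    added set itself. *)
Lemma maximal_kwise_of_cofamily (k n : nat) (D : {set {set 'I_n}}) :
  (forall G : {set {set 'I_n}}, G \subset D -> #|G| <= k -> \bigcup_(B in G) B != setT) ->
  (forall B, B \notin D -> exists G : {set {set 'I_n}},
     [/\ G \subset D, #|G| < k & B :|: \bigcup_(A in G) A = setT]) ->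
  maximal_kwise_intersecting k [set ~: B | B in D].
Proof.
move=> ncov sat.
have bigC (G : {set {set 'I_n}}) :
    \bigcup_(B in [set ~: A | A in G]) B = ~: \bigcap_(A in G) A.
  by rewrite setC_bigcap big_imset //= => A B _ _ /setC_inj.
apply/andP; split.
  apply/forallP => G; apply/implyP => /and3P[/subsetP GF _ cardG].
  have := ncov [set ~: A | A in G]; rewrite bigC card_imset; last exact: setC_inj.
  rewrite -setC0 (inj_eq (@setC_inj _)); apply=> //.
  by apply/subsetP => _ /imsetP[A /GF/imsetP[B BD ->] ->]; rewrite setCK.
apply/forallP => A; apply/implyP => AF.
have /sat[G [/subsetP GD cardG cov]] : ~: A \notin D.
  by apply: contra AF => AD; rewrite -[A]setCK imset_f.
apply/negP => /forallP/(_ (A |: [set ~: B | B in G])) /implyP.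
rewrite bigcap_setU big_set1 big_imset /=; last by move=> ? ? _ _ /setC_inj.
rewrite -setC_bigcup -[A in A :&: _]setCK -setCU cov setCT eqxx => /(_ _) /negP; apply => //.
apply/and3P; split.
- apply: setUS; apply/subsetP => _ /imsetP[B /GD BD ->]; exact: imset_f.
- by apply/set0Pn; exists A; rewrite setU11.
rewrite cardsU1 card_imset; last exact: setC_inj.
by case: (_ \notin _); [rewrite add1n | exact: ltnW].
Qed.

Lemma f_le_card (k n : nat) (F : {set {set 'I_n}}) :
  maximal_kwise_intersecting k F -> f k n <= #|F|.
Proof.
move=> maxF; rewrite /f; case: ex_minnP => s _; apply.
by apply/existsP; exists F; rewrite maxF eqxx.
Qed.

(** * Realisation on ['I_n] and the bound *)

Lemma labelling_exists (q n p : nat) (m : 'I_q -> nat) :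
  n = q.+1 + p.+1 + \sum_(i < q) m i ->
  exists (lab : 'I_n -> option 'I_q) (c v : 'I_n) (x : 'I_q -> 'I_n),
    [/\ forall i, #|block lab i| = m i, #|core lab| = q.+1 + p.+1,
        injective x, forall i, x i != c
      & [/\ v != c, forall i, v != x i, c \in core lab, v \in core lab
          & forall i, x i \in core lab]].
Proof.
(* In this model of the ground set, tagged elements form the blocks, [None] is the hub, [Some i] is
   the point [x i], and ['I_p.+1] is the rest of the core, with [ord0] as [v]. *)
move=> nE; pose T : finType := ({i : 'I_q & 'I_(m i)} + (option 'I_q + 'I_p.+1))%type.
have cardT : n = #|T|.
  rewrite !card_sum card_option !card_ord card_tagged nE addnC; congr addn.
  by rewrite sumnE big_map big_enum; apply: eq_bigr => i _; rewrite card_ord.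
pose b (t : 'I_n) : T := enum_val (cast_ord cardT t).
pose b' (y : T) : 'I_n := cast_ord (esym cardT) (enum_rank y).
have b'K : cancel b' b by move=> y; rewrite /b /b' cast_ordKV enum_rankK.
have bK : cancel b b' by move=> t; rewrite /b /b' enum_valK cast_ordK.
have b'_inj := can_inj b'K.
pose lab t := if b t is inl y then Some (tag y) else None.
exists lab, (b' (inr (inl None))), (b' (inr (inr ord0))), (fun i => b' (inr (inl (Some i)))).
split.
- move=> i; have -> : block lab i = [set b' (inl (Tagged (fun i => 'I_(m i)) j)) | j : 'I_(m i)].
    apply/setP => t; apply/idP/imsetP => [|[j _ ->]]; last by rewrite inE /lab b'K.
    rewrite inE /lab; case E: (b t) => [[j y]|//] /eqP [ji].
    by move: y E; rewrite ji => y E; exists y; rewrite // -(bK t) E.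
  by rewrite card_imset ?card_ord // => j j' /b'_inj [] /eqP; rewrite eq_Tagged => /eqP.
- have -> : core lab = [set b' (inr y) | y : option 'I_q + 'I_p.+1].
    apply/setP => t; apply/idP/imsetP => [|[j _ ->]]; last by rewrite inE /lab b'K.
    by rewrite inE /lab; case E: (b t) => [//|y] _; exists y; rewrite // -(bK t) E.
  by rewrite card_imset ?card_sum ?card_option ?card_ord // => y y' /b'_inj [].
- by move=> i j /b'_inj [].
- by move=> i; rewrite (inj_eq b'_inj).
- by split=> [|i|||i]; rewrite ?(inj_eq b'_inj) // inE /lab b'K.
Qed.

Theorem theorem2 (k n : nat) (m : nat -> nat)
    (hk : 4 <= k)
    (hn : 0 < n)
    (hm : forall i, 1 <= i <= k - 1 -> 0 < m i)
    (hnm : n = (k - 1) + \sum_(1 <= i < (k - 1).+1) m i) :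
  f k n <= 4 * (\sum_(1 <= i < (k - 2).+1) 2 ^ m i)
           + 2 ^ (k - 2) * 2 ^ m (k - 1) - 7 * (k - 2).
Proof.
have [q kE] : exists q, k = q.+2 by exists (k - 2); lia.
have k1 : k - 1 = q.+1 by lia.
have k2 : k - 2 = q by lia.
have sumE (F : nat -> nat) r : \sum_(1 <= i < r.+1) F i = \sum_(i < r) F i.+1.
  by rewrite big_add1 big_mkord.
have m_gt0 i : i <= q -> 0 < m i.+1 by move=> iq; apply: hm; lia.
(* Positivity of the last [m] provides the core point [v]. *)
have [p pE] : exists p, m q.+1 = p.+1 by exists (m q.+1).-1; rewrite prednK ?m_gt0.
rewrite k1 k2 sumE in hnm *; rewrite pE.
have nE : n = q.+1 + p.+1 + \sum_(i < q) m i.+1.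
  by rewrite hnm big_ord_recr /= pE addnCA addnC.
have [lab [c [v [x [cardB cardW x_inj xc [vc vx cW vW xW]]]]]] := labelling_exists nE.
have lab_surj i : exists t, lab t = Some i.
  have : 0 < #|block lab i| by rewrite cardB m_gt0 // ltnW.
  by case/card_gt0P => t; rewrite inE => /eqP; exists t.
(* From [4 <= k] there are at least two spokes, as the pivots require. *)
have q_gt1 : 1 < q by lia.
have maxF : maximal_kwise_intersecting k [set ~: B | B in cofamily lab c x].
  apply: maximal_kwise_of_cofamily => [G sub|B BF]; rewrite kE.
    by apply: (@cofamily_not_cover _ _ _ c v).
  exact: (@cofamily_saturated _ _ _ c v).
apply: leq_trans (f_le_card maxF) _.
rewrite card_imset; last exact: setC_inj.
have := card_cofamily q_gt1 lab_surj cW vW xW xc vc vx.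
rewrite cardW (eq_bigr (fun i : 'I_q => 2 ^ m i.+1)) => [le|i _]; last by rewrite cardB.
(* Subtraction truncates, so [7 * q] is added to both sides; that it does not exceed the bound
   follows from the same count [le]. *)
rewrite sumE -expnD [4 * _ + _]addnC -(leq_add2r (7 * q)) subnK.
  by apply: leq_trans le _; rewrite addSn.
by apply: leq_trans (leq_addl _ _) (leq_trans le _); rewrite addSn.
Qed.
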